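(* Let $C_1,C_2>0$, $\delta_1,\delta_2\ge 0$, and $k_i\in\mathcal{K}_{C_i,\delta_i}$, $i=1,2$. Put $\delta=\max\{\delta_1,\delta_2\}$. (1) With $C=C_1+C_2$, the function $k_1\ast k_2$ belongs to $\mathcal{K}_{C,\delta}$, and $$\|k_1\ast k_2\|_{C,\delta}\le \|k_1\|_{C_1,\delta_1}\,\|k_2\|_{C_2,\delta_2}.$$ (2) If $\delta\ge 1$ and $C_1\ne C_2$, then $k_1\ast k_2\in\mathcal{K}_{\bar C,\delta}$, where $\bar C=\max\{C_1,C_2\}$, and $$\|k_1\ast k_2\|_{\bar C,\delta}\le \frac{\bar C}{|C_1-C_2|}\,\|k_1\|_{C_1,\delta_1}\,\|k_2\|_{C_2,\delta_2}.$$ (3) If $\delta\ge 1$ and $C_1=C_2$, then for any $C'>C_1$ one has $k_1\ast k_2\in\mathcal{K}_{C',\delta}$ and $$\|k_1\ast k_2\|_{C',\delta}\le \frac{C'}{e\,C_1\ln\frac{C'}{C_1}}\,\|k_1\|_{C_1,\delta_1}\,\|k_2\|_{C_2,\delta_2}.$$ (4) If $k_1\in\mathcal{K}_{C_1,\delta_1}$ with $C_1>1$, $\delta_1\ge 1$, and (in place of the assumption $k_2\in\mathcal{K}_{C_2,\delta_2}$) $k_2\in L^\infty(\Gamma_0)$, then $k_1\ast k_2\in\mathcal{K}_{C_1,\delta_1}$ and $$\|k_1\ast k_2\|_{C_1,\delta_1}\le \frac{C_1}{C_1-1}\,\|k_1\|_{C_1,\delta_1}\,\|k_2\|_{L^\infty(\Gamma_0)}.$$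 (5) If (in place of the assumptions $k_i\in\mathcal{K}_{C_i,\delta_i}$, $i=1,2$) $k_1,k_2\in L^\infty(\Gamma_0)$, then $k_1\ast k_2\in\mathcal{K}_{C,0}$ for all $C\ge 2$ and $k_1\ast k_2\in\mathcal{K}_{C,\delta}$ for all $\delta>0$, $C>0$; in particular, $$\|k_1\ast k_2\|_{C,0}\le\|k_1\|_{L^\infty(\Gamma_0)}\,\|k_2\|_{L^\infty(\Gamma_0)},\qquad C\ge 2.$$
   Context: Let $X$ be a connected oriented non-compact Riemannian $C^\infty$-manifold with Borel $\sigma$-algebra $\mathcal{B}(X)$, and let $\mathcal{B}_{\mathrm c}(X)$ be the class of Borel sets with compact closure. Let $m$ be a non-atomic Radon measure on $X$: $m(\Lambda)<\infty$ for $\Lambda\in\mathcal{B}_{\mathrm c}(X)$ and $m(\{x\})=0$ for $x\in X$. Assume there is an increasing sequence $\Lambda_n\in\mathcal{B}_{\mathrm c}(X)$ with $\bigcup_n\Lambda_n=X$. For $n\in\mathbb{N}$ let $\Gamma^{(n)}=\{\eta\subset X: |\eta|=n\}$, where $|\eta|$ is the number of points of $\eta$; $\Gamma^{(0)}=\{\emptyset\}$. $\Gamma^{(n)}$ is identified with the quotient of $\widetilde{X^n}=\{(x_1,\dots,x_n)\in X^n: x_k\neq x_l \text{ if } k\ne l\}$ by the permutation group $S_n$ and carries the quotient topology. The space of finite configurations is the disjoint union $\Gamma_0=\bigsqcup_{n\ge 0}\Gamma^{(n)}$ with the disjoint-union topology and its Borel $\sigma$-algebra. Let $m^{(n)}$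 be the image on $\Gamma^{(n)}$ of $m^{\otimes n}$ (restricted to $\widetilde{X^n}$) under $(x_1,\dots,x_n)\mapsto\{x_1,\dots,x_n\}$, and $m^{(0)}(\{\emptyset\})=1$. The Lebesgue--Poisson measure is $\lambda=\sum_{n=0}^\infty\frac1{n!}m^{(n)}$ on $\Gamma_0$. For measurable $G_1,G_2:\Gamma_0\to\mathbb{R}$, the $\ast$-convolution is $(G_1\ast G_2)(\eta)=\sum_{\xi\subset\eta}G_1(\xi)G_2(\eta\setminus\xi)$ (sum over all subsets $\xi$ of $\eta$, including $\emptyset$ and $\eta$). For $C>0$, $\delta\ge0$, $\mathcal{K}_{C,\delta}$ is the Banach space of measurable functions $k:\Gamma_0\to\mathbb{R}$ (up to $\lambda$-a.e. equality) with $|k(\eta)|\le \mathrm{const}\cdot C^{|\eta|}(|\eta|!)^\delta$ for $\lambda$-a.a. $\eta$, with norm $\|k\|_{C,\delta}=\operatorname{ess\,sup}_{\eta\in\Gamma_0}\frac{|k(\eta)|}{C^{|\eta|}(|\eta|!)^\delta}$ (ess sup with respect to $\lambda$). $L^\infty(\Gamma_0)=L^\infty(\Gamma_0,d\lambda)$. *)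

(* Defs.v *)
From HB Require Import structures.
From mathcomp Require Import all_boot all_order all_algebra finmap.
From mathcomp Require Import all_classical all_reals all_analysis ess_sup_inf.

Set Implicit Arguments.
Unset Strict Implicit.
Unset Printing Implicit Defensive.

Import Order.TTheory GRing.Theory Num.Theory.
Import numFieldNormedType.Exports.

Local Open Scope classical_set_scope.
Local Open Scope ring_scope.

Section Smooth.
Context {R : realType} {d : nat} {W : normedModType R}.

(* [partial [:: i1; ..; ik] f] is the iterated partial derivative
   d_i1 ... d_ik f. *)
Fixpoint partial (s : seq 'I_d.+1) (f : 'rV[R]_d.+1 -> W) : 'rV[R]_d.+1 -> W :=
  if s is i :: s' then fun x => 'D_(delta_mx 0 i) (partial s' f) x else f.

(* C^oo, for U open. *)
Definition smooth_on (U : set 'rV[R]_d.+1) (f : 'rV[R]_d.+1 -> W) : Prop :=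
  forall s x, U x ->
    {for x, continuous (partial s f)} /\
    forall i, derivable (partial s f) x (delta_mx 0 i).

End Smooth.

(* Dimension is [d.+1]: a connected manifold of dimension 0 is a point, hence
   compact.  The carrier is pointed because a non-compact space is nonempty.
   The atlas need not be maximal.  Vectors are rows, so a differential acts on
   the right, [v |-> v *m 'J f x], and the metric in the chart [i] is
   [(v, w) |-> v *m metric i x *m w^T]. *)
Record oriented_riemannian_manifold (R : realType) (d : nat) := {
  mfd_carrier :> ptopologicalType ;
  mfd_hausdorff : hausdorff_space mfd_carrier ;
  mfd_second_countable : second_countable (T := mfd_carrier) ;
  mfd_index : Type ;
  mfd_dom : mfd_index -> set mfd_carrier ;
  mfd_chart : mfd_index -> mfd_carrier -> 'rV[R]_d.+1 ;
  mfd_param : mfd_index -> 'rV[R]_d.+1 -> mfd_carrier ;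
  mfd_dom_open : forall i, open (mfd_dom i) ;
  mfd_dom_cover : \bigcup_i mfd_dom i = setT ;
  mfd_cod_open : forall i, open (mfd_chart i @` mfd_dom i) ;
  mfd_chartK : forall i x, mfd_dom i x -> mfd_param i (mfd_chart i x) = x ;
  mfd_chart_continuous : forall i, {within mfd_dom i, continuous (mfd_chart i)} ;
  mfd_param_continuous : forall i,
    {within mfd_chart i @` mfd_dom i, continuous (mfd_param i)} ;
  mfd_transition_smooth : forall i j,
    smooth_on (mfd_chart i @` (mfd_dom i `&` mfd_dom j))
              (mfd_chart j \o mfd_param i) ;
  mfd_oriented : forall i j x, (mfd_dom i `&` mfd_dom j) x ->
    0 < \det ('J (mfd_chart j \o mfd_param i) (mfd_chart i x)) ;
  mfd_metric : mfd_index -> 'rV[R]_d.+1 -> 'M[R]_d.+1 ;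
  mfd_metric_smooth : forall i,
    smooth_on (mfd_chart i @` mfd_dom i) (mfd_metric i) ;
  mfd_metric_sym : forall i x, mfd_dom i x ->
    (mfd_metric i (mfd_chart i x))^T = mfd_metric i (mfd_chart i x) ;
  mfd_metric_pos : forall i x (v : 'rV[R]_d.+1), mfd_dom i x -> v != 0 ->
    0 < (v *m mfd_metric i (mfd_chart i x) *m v^T) 0 0 ;
  mfd_metric_compat : forall i j x, (mfd_dom i `&` mfd_dom j) x ->
    let J := 'J (mfd_chart j \o mfd_param i) (mfd_chart i x) in
    mfd_metric i (mfd_chart i x) = J *m mfd_metric j (mfd_chart j x) *m J^T
}.

Notation borel T := (g_sigma_algebraType (@open T)).

Definition bounded_borel (X : ptopologicalType) : set (set X) :=
  [set L : set X | measurable (L : set (borel X)) /\ compact (closure L)].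

Section Intensity.
Context (R : realType) (X : ptopologicalType).

Record nonatomic_radon := {
  nr_measure : {measure set (borel X) -> \bar R} ;
  nr_radon : forall L, bounded_borel L -> (nr_measure L < +oo)%E ;
  nr_nonatomic : forall x, nr_measure [set x] = 0%E ;
  (* An assumption on X alone, kept here as it makes the measure sigma-finite. *)
  nr_exhaustion : exists L : (set X)^nat,
    [/\ forall n, bounded_borel (L n),
        forall n, L n `<=` L n.+1 & \bigcup_n L n = setT]
}.

Variable m : nonatomic_radon.

Definition intensity : set (borel X) -> \bar R := nr_measure m.

HB.instance Definition _ := Measure.on intensity.

Let intensity_sigma_finite : sigma_finite setT intensity.
Proof.
case: (nr_exhaustion m) => L [bL _ covL]; exists L; first by rewrite covL.
by move=> n; split; [case: (bL n)|exact: nr_radon].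
Qed.

HB.instance Definition _ := Measure_isSigmaFinite.Build _ _ _
  intensity intensity_sigma_finite.

End Intensity.

Section TupleMeasure.
Local Open Scope ereal_scope.
Context d (T : measurableType d) (R : realType).

Section Step.
Context (mu : {sigma_finite_measure set T -> \bar R}) (n : nat)
  (nu : {sigma_finite_measure set (n.-tuple T) -> \bar R}).

Let tcons (p : T * n.-tuple T) : n.+1.-tuple T := [tuple of p.1 :: p.2].

Let measurable_tcons : measurable_fun setT tcons.
Proof. exact: measurable_cons. Qed.

Let tcons_preimage_measurable A : measurable A -> measurable (tcons @^-1` A).
Proof. by move=> mA; rewrite -[_ @^-1` _]setTI; exact: measurable_tcons. Qed.

(* The image of [mu \x nu] under (x, (x_1, .., x_n)) |-> (x, x_1, .., x_n). *)
Definition cons_measure : set (n.+1.-tuple T) -> \bar R :=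
  pushforward (mu \x nu) (fun p => [tuple of p.1 :: p.2]).

Let cons_measure0 : cons_measure set0 = 0.
Proof. by rewrite /cons_measure /pushforward preimage_set0 measure0. Qed.

Let cons_measure_ge0 A : 0 <= cons_measure A.
Proof. exact: measure_ge0. Qed.

Let cons_measure_sigma_additive : semi_sigma_additive cons_measure.
Proof.
move=> F mF tF mUF; rewrite /cons_measure /pushforward preimage_bigcup.
apply: measure_semi_sigma_additive.
- by move=> k; exact: tcons_preimage_measurable.
- apply/trivIsetP => /= i j _ _ ij; rewrite -preimage_setI.
  by move/trivIsetP : tF => /(_ _ _ _ _ ij) ->//; rewrite preimage_set0.
- by rewrite -preimage_bigcup; exact: tcons_preimage_measurable.
Qed.

HB.instance Definition _ := isMeasure.Build _ _ _ cons_measure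
  cons_measure0 cons_measure_ge0 cons_measure_sigma_additive.

Let cons_measure_sigma_finite : sigma_finite setT cons_measure.
Proof.
have /sigma_finiteP[F [TF ndF Foo]] := sigma_finiteT mu.
have /sigma_finiteP[G [TG ndG Goo]] := sigma_finiteT nu.
pose f (t : n.+1.-tuple T) : T * n.-tuple T := (thead t, [tuple of behead t]).
have mf : measurable_fun setT f.
  apply/measurable_fun_pair; [exact: measurable_tnth|].
  exact: measurable_behead.
have fK : f \o tcons = id.
  by apply/funext => -[x t]; rewrite /f /= theadE; congr pair; exact/val_inj.
exists (fun k => f @^-1` (F k `*` G k)).
  rewrite -preimage_bigcup (_ : \bigcup_k _ = setT)// -setXTT TF TG.
  rewrite predeqE => -[x y]; split.
    by move=> [k _ []/= ? ?]; split; exists k.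
  move=> [/= [i _ Fix] [k _ Gky]]; exists (maxn i k) => //; split.
  - by move: x Fix; exact/subsetPset/ndF/leq_maxl.
  - by move: y Gky; exact/subsetPset/ndG/leq_maxr.
move=> k; have [mFk ?] := Foo k; have [mGk ?] := Goo k; split.
  by rewrite -[_ @^-1` _]setTI; apply: mf => //; exact: measurableX.
rewrite /cons_measure /pushforward -[X in (mu \x nu) X]comp_preimage.
rewrite -/tcons fK preimage_id.
by rewrite product_measure1E// lte_mul_pinfty// ge0_fin_numE.
Qed.

HB.instance Definition _ := Measure_isSigmaFinite.Build _ _ _
  cons_measure cons_measure_sigma_finite.

End Step.

Fixpoint tuple_measure (mu : {sigma_finite_measure set T -> \bar R}) (n : nat) :
    {sigma_finite_measure set (n.-tuple T) -> \bar R} :=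
  if n is k.+1 then cons_measure mu (tuple_measure mu k)
  else \d_([tuple] : 0.-tuple T).

End TupleMeasure.

HB.instance Definition _ (n : nat) (X : topologicalType) :=
  Topological.copy (n.-tuple X)
    (initial_topology (fun t : n.-tuple X =>
       (tnth t : {ptws 'I_n -> X}))).

Definition distinct_tuples (n : nat) (X : choiceType) : set (n.-tuple X) :=
  [set t | uniq t].
Arguments distinct_tuples : clear implicits.

Definition Gamma (n : nat) (X : choiceType) : Type :=
  {eta : {fset X} | #|` eta| == n}.

HB.instance Definition _ n X := Choice.on (Gamma n X).

Definition tuple_set (n : nat) (X : choiceType) (t : n.-tuple X) : {fset X} :=
  [fset x in (t : seq X)]%fset.

Lemma card_tuple_set (n : nat) (X : choiceType) (t : distinct_tuples n X) :
  #|` tuple_set (set_val t)| == n.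
Proof.
have ut : uniq (set_val t) by exact: (set_valP t).
by rewrite /tuple_set card_fseq undup_id// size_tuple.
Qed.

Definition Gamma_proj (n : nat) (X : choiceType) (t : distinct_tuples n X) :
  Gamma n X := exist _ (tuple_set (set_val t)) (card_tuple_set t).

Section GammaTopology.
Context (n : nat) (X : topologicalType).

(* The quotient topology: [Gamma_proj] identifies [Gamma n X] with the quotient
   of [distinct_tuples n X] by the permutations of the entries. *)
Definition Gamma_open : set (set (Gamma n X)) :=
  [set U | open (@Gamma_proj n X @^-1` U)].

Let Gamma_openT : Gamma_open setT.
Proof. by rewrite /Gamma_open /= preimage_setT; exact: openT. Qed.

Let Gamma_openI : setI_closed Gamma_open.
Proof. by move=> A B oA oB; exact: openI. Qed.

Let Gamma_open_bigU (I : Type) (f : I -> set (Gamma n X)) :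
  (forall i, Gamma_open (f i)) -> Gamma_open (\bigcup_i f i).
Proof.
by move=> of_; rewrite /Gamma_open /= preimage_bigcup; apply: bigcup_open => i _; exact: of_.
Qed.

HB.instance Definition _ := isOpenTopological.Build (Gamma n X)
  Gamma_openT Gamma_openI Gamma_open_bigU.

End GammaTopology.

(* The disjoint union of the [Gamma n X], i.e. all finite subsets of X;
   [Gamma0_open] is the disjoint-union topology. *)
Definition Gamma0 (X : choiceType) : Type := {fset X}.

HB.instance Definition _ X := Choice.on (Gamma0 X).
HB.instance Definition _ (X : choiceType) :=
  isPointed.Build (Gamma0 X) (fset0 : {fset X}).

Section Gamma0Topology.
Context (X : topologicalType).

Definition Gamma0_open : set (set (Gamma0 X)) :=
  [set U | forall n, open [set eta : Gamma n X | U (val eta)]].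

Let Gamma0_openT : Gamma0_open setT.
Proof. by move=> n; exact: openT. Qed.

Let Gamma0_openI : setI_closed Gamma0_open.
Proof. by move=> A B oA oB n; exact: openI. Qed.

Let Gamma0_open_bigU (I : Type) (f : I -> set (Gamma0 X)) :
  (forall i, Gamma0_open (f i)) -> Gamma0_open (\bigcup_i f i).
Proof. by move=> of_ n; apply: bigcup_open => i _; exact: of_. Qed.

HB.instance Definition _ := isOpenTopological.Build (Gamma0 X)
  Gamma0_openT Gamma0_openI Gamma0_open_bigU.

End Gamma0Topology.

Section BorelTuples.
Context (X : ptopologicalType).
Hypothesis X2 : second_countable (T := X).
Hypothesis XT2 : hausdorff_space X.

Lemma open_tuple_box n (O : set (n.-tuple X)) (t : n.-tuple X) :
  open O -> O t -> exists V : 'I_n -> set X,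
    (forall i, open_nbhs (tnth t i) (V i)) /\
    [set s | forall i, V i (tnth s i)] `<=` O.
Proof.
move=> [W oW <-] /= Wt.
pose D : set ('I_n -> set X) := [set V | forall i, open_nbhs (tnth t i) (V i)].
pose box (V : 'I_n -> set X) : set {ptws 'I_n -> X} :=
  [set f | forall i, V i (f i)].
pose F := filter_from D box.
have FF : Filter F.
  apply: filter_from_filter.
    by exists (fun=> setT) => i; split => //; exact: openT.
  move=> V1 V2 D1 D2; exists (fun i => V1 i `&` V2 i).
    by move=> i; exact: open_nbhsI.
  by move=> f Vf; split => i; have [] := Vf i.
have : F --> (tnth t : {ptws 'I_n -> X}).
  apply/cvg_sup => i A [_ [[C oC <-] /= Ct CA]].
  exists (fun j => if j == i then C else setT).
    move=> j; case: eqP => [->//|_].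
    by split => //; exact: openT.
  by move=> f /(_ i); rewrite eqxx => Cf; exact: CA.
have nW : nbhs (tnth t : {ptws 'I_n -> X}) W by exact: open_nbhs_nbhs.
by move=> /(_ _ nW)[V DV VW]; exists V; split => // s Vs; exact: VW.
Qed.

Lemma open_tuple_measurable n (O : set (n.-tuple X)) :
  open O -> measurable (O : set (n.-tuple (borel X))).
Proof.
move=> oO; have [B /countable_injP[f finj] [Bo Bb]] := X2.
pose e k := get [set b | B b /\ f b = k].
have eB b : B b -> e (f b) = b.
  move=> Bb'; have [|Be fe] := @getPex _ [set c | B c /\ f c = f b].
    by exists b.
  by apply: finj => //; exact/mem_set.
pose box (c : n.-tuple nat) : set (n.-tuple X) :=
  [set s | forall i, e (tnth c i) (tnth s i)].
pose ok c := box c `<=` O /\ forall i, open (e (tnth c i)).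
have -> : O = \bigcup_(c : n.-tuple nat) (if `[< ok c >] then box c else set0).
  apply/seteqP; split => [t Ot|t [c _]]; last first.
    by case: asboolP => // -[cO _]; exact: cO.
  have [V [Vo VO]] := open_tuple_box oO Ot.
  have Ub i : exists b, [/\ B b, b (tnth t i) & b `<=` V i].
    have [|U [BU Ut] UV] := Bb (tnth t i) (V i).
      exact/open_nbhs_nbhs.
    by exists U.
  have [b bP] := choice Ub.
  exists [tuple f (b i) | i < n] => //.
  rewrite asboolT; first by move=> i; rewrite tnth_mktuple eB; have [] := bP i.
  split=> [s sb|i]; last first.
    by have [Bbi _ _] := bP i; rewrite tnth_mktuple eB//; exact: Bo.
  apply: VO => i; have [Bbi _] := bP i; apply.
  by move: (sb i); rewrite tnth_mktuple eB.
apply: countable_bigcupT_measurable => // c.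
case: asboolP => [[_ oc]|_]; last exact: measurable0.
rewrite (_ : box c = \bigcap_(i in [set: 'I_n])
    ((fun s : n.-tuple (borel X) => tnth s i) @^-1` (e (tnth c i)))); last first.
  by apply/seteqP; split => s /= sc i; [move=> _|]; exact: sc.
apply: fin_bigcap_measurable => // i _.
rewrite -[_ @^-1` _]setTI; apply: measurable_tnth => //.
exact: sub_sigma_algebra.
Qed.

Lemma tnth_continuous n (i : 'I_n) :
  continuous ((@tnth n X)^~ i : n.-tuple X -> X).
Proof.
move=> t; apply: (@continuous_comp _ {ptws 'I_n -> X} _
  (@tnth n X : n.-tuple X -> {ptws 'I_n -> X}) (fun f => f i)).
  exact: initial_continuous.
exact: (@proj_continuous _ (fun=> X) i).
Qed.

Lemma distinct_tuples_measurable n :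
  measurable (distinct_tuples n X : set (n.-tuple (borel X))).
Proof.
rewrite (_ : distinct_tuples n X =
    \bigcap_(ij in [set ij : 'I_n * 'I_n | ij.1 != ij.2])
    [set t | tnth t ij.1 != tnth t ij.2]); last first.
  apply/seteqP; split => [t /= ut [i j] /= ij|t /= tP].
    by apply: contra_neq ij => tij; exact: (tuple_uniqP t ut).
  apply/tuple_uniqP => i j tij; apply/eqP/negP => /negP ij.
  by have := tP (i, j) ij; rewrite /= tij eqxx.
apply: fin_bigcap_measurable => // -[i j] /= _.
apply: open_tuple_measurable; rewrite openE => t /= tij.
move: XT2; rewrite open_hausdorff => /(_ _ _ tij)[[A B] /= [At Bt] [oA oB AB0]].
have nA : nbhs t [set s | A (tnth s i)].
  apply: (@tnth_continuous n i t); apply: open_nbhs_nbhs.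
  by split => //; exact/set_mem.
have nB : nbhs t [set s | B (tnth s j)].
  apply: (@tnth_continuous n j t); apply: open_nbhs_nbhs.
  by split => //; exact/set_mem.
apply: filterS (filterI nA nB) => s [/= As Bs].
apply/eqP => sij; suff : (A `&` B) (tnth s i) by rewrite (eqP AB0).
by split => //; rewrite sij.
Qed.

Lemma distinct_preimage_measurable n (A : set (borel (Gamma0 X))) :
  measurable A ->
  measurable (distinct_tuples n X `&` (@tuple_set n X) @^-1` A
    : set (n.-tuple (borel X))).
Proof.
have mD := @distinct_tuples_measurable n.
pose Q : set (set (borel (Gamma0 X))) := [set A |
  measurable (distinct_tuples n X `&` (@tuple_set n X) @^-1` A
    : set (n.-tuple (borel X)))].
suff : (measurable : set (set (borel (Gamma0 X)))) `<=` Q by exact.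
apply: smallest_sub.
  split; rewrite /Q /=.
  - by rewrite preimage_set0 setI0.
  - move=> B mB; rewrite setTD (_ : _ `&` _ = distinct_tuples n X `\`
      (distinct_tuples n X `&` (@tuple_set n X) @^-1` B)).
      exact: measurableD.
    by rewrite setDIr setDv set0U.
  - move=> F mF; rewrite preimage_bigcup setI_bigcupr.
    exact: bigcupT_measurable.
move=> U /(_ n)[W oW WU]; rewrite /Q /=.
rewrite (_ : _ `&` _ = distinct_tuples n X `&` W).
  by apply: measurableI => //; exact: open_tuple_measurable.
apply/seteqP; split => t [ut Ut]; split => //.
- have : (set_val @^-1` W) (SigSub (mem_set ut)) by rewrite WU.
  by [].
- have : (set_val @^-1` W) (SigSub (mem_set ut)) by exact: Ut.
  by rewrite WU.
Qed.

End BorelTuples.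

Section LebesguePoisson.
Context (R : realType) (d : nat) (X : oriented_riemannian_manifold R d)
  (m : nonatomic_radon R X).

(* The image on Gamma_0 of the product measure restricted to the tuples with
   distinct entries; it is carried by the configurations with n points. *)
Definition Gamma_measure (n : nat) : set (borel (Gamma0 X)) -> \bar R :=
  fun A => tuple_measure (intensity m) n
    (distinct_tuples n X `&` @tuple_set n X @^-1` A).

Section measure.
Variable n : nat.

Let mA (A : set (borel (Gamma0 X))) : measurable A ->
  measurable (distinct_tuples n X `&` @tuple_set n X @^-1` A
    : set (n.-tuple (borel X))).
Proof.
apply: distinct_preimage_measurable; first exact: mfd_second_countable.
exact: mfd_hausdorff.
Qed.

Let Gamma_measure0 : Gamma_measure n set0 = 0%E.
Proof. by rewrite /Gamma_measure preimage_set0 setI0 measure0. Qed.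

Let Gamma_measure_ge0 A : (0 <= Gamma_measure n A)%E.
Proof. exact: measure_ge0. Qed.

Let Gamma_measure_sigma_additive : semi_sigma_additive (Gamma_measure n).
Proof.
move=> F mF tF mUF; rewrite /Gamma_measure preimage_bigcup setI_bigcupr.
apply: measure_semi_sigma_additive.
- by move=> k; exact: mA.
- apply/trivIsetP => /= i j _ _ ij; rewrite setIACA setIid -preimage_setI.
  by move/trivIsetP : tF => /(_ _ _ _ _ ij) ->//; rewrite preimage_set0 setI0.
- by rewrite -setI_bigcupr -preimage_bigcup; exact: mA.
Qed.

HB.instance Definition _ := isMeasure.Build _ _ _ (Gamma_measure n)
  Gamma_measure0 Gamma_measure_ge0 Gamma_measure_sigma_additive.

End measure.

Definition lebesgue_poisson : {measure set (borel (Gamma0 X)) -> \bar R} :=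
  mseries (fun n => mscale (n`!%:R^-1)%:nng (Gamma_measure n)) 0.

End LebesguePoisson.

Definition star_convolution (R : realType) (X : choiceType)
    (G1 G2 : Gamma0 X -> R) : Gamma0 X -> R :=
  fun eta => \sum_(xi <- fpowerset eta) G1 xi * G2 (eta `\` xi)%fset.

Section Spaces.
Context (R : realType) (X : ptopologicalType)
  (lam : {measure set (borel (Gamma0 X)) -> \bar R}).

Definition K_weight (C delta : R) (eta : Gamma0 X) : R :=
  C ^+ #|` eta| * ((#|` eta|)`!%:R `^ delta).

(* The elements are functions, not classes modulo [lam]-a.e. equality.  Applied
   to differences of representatives, the norm bounds for [star_convolution]
   show that it is compatible with a.e. equality. *)
Definition K_space (C delta : R) : set (borel (Gamma0 X) -> R) :=
  [set k : borel (Gamma0 X) -> R |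
    measurable_fun setT k /\
    exists M : R, \forall eta \ae lam, `|k eta| <= M * K_weight C delta eta].

Definition K_norm (C delta : R) (k : borel (Gamma0 X) -> R) : \bar R :=
  ess_sup lam (fun eta => (`|k eta| / K_weight C delta eta)%:E).

End Spaces.

(* Main.v *)
Require Import Defs.
From mathcomp Require Import all_boot all_order all_algebra finmap.
From mathcomp Require Import all_classical all_reals all_analysis ess_sup_inf.
From mathcomp Require Import ring lra.

(** The five bounds are instances of one estimate.  Write w_i for the weight
    C_i ^ |eta| * (|eta|!) ^ delta_i.  If |k_i| <= M_i * w_i almost everywhere,
    then |k_1 * k_2| <= M_1 M_2 (w_1 * w_2) almost everywhere, where the stars
    between functions are convolutions; so as soon as w_1 * w_2 <= c w pointwise
    for the target weight w, the convolution is in the target space with norm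
    at most c times the product of the norms ([star_bound]).  The space of
    essentially bounded functions is the case C = 1, delta = 0.

    The convolution of two weights at a configuration of n points is
    sum_j binom(n, j) C_1^j C_2^(n-j) (j!)^delta_1 ((n-j)!)^delta_2.
    Put delta = max(delta_1, delta_2).  Since j! (n-j)! <= n!, this is at most
    (C_1 + C_2)^n (n!)^delta.  If delta >= 1, the factor (n!)^delta also
    absorbs the binomial coefficient, because
    binom(n, j) (j! (n-j)!)^delta <= (n!)^delta; what remains is the geometric
    sum of the C_1^j C_2^(n-j), which is at most
    max(C_1, C_2)^(n+1) / |C_1 - C_2| when C_1 <> C_2, and (n+1) C_1^n when
    C_1 = C_2, to which x <= e^(x-1) applies.

    Two facts about the configuration space make the estimate legitimate.

    First, an almost sure property of configurations holds, for almost every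
    eta, at all subsets of eta simultaneously ([ae_forall_subset]).  In terms
    of tuples, a subset of {x_1, ..., x_n} is obtained by erasing some of the
    coordinates, and erasing coordinates pulls null sets back to null sets for
    product measures, by Fubini ([tmask_null]).

    Second, the convolution is Borel measurable ([measurable_star]).  On tuples
    it is a finite sum of products of measurable functions, and measurability
    on tuples descends to the quotient ([measurable_Gamma0]): the tuples with
    distinct entries are covered by countably many open sets on which the
    projection to configurations is injective; the projection is open, hence it
    sends Borel subsets of each of these open sets to Borel sets. *)

Set Implicit Arguments.
Unset Strict Implicit.
Unset Printing Implicit Defensive.

Import Order.TTheory GRing.Theory Num.Theory.
Import numFieldNormedType.Exports.

Local Open Scope classical_set_scope.
Local Open Scope ring_scope.

(** * Convolution of weights *)

Lemma sum_fpowerset_card (V : nmodType) (X : choiceType) (eta : {fset X})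
    (F : nat -> V) :
  \sum_(xi <- fpowerset eta) F #|` xi| =
  \sum_(j < #|` eta|.+1) F j *+ 'C(#|` eta|, j).
Proof.
have cardY (Y : {set eta}) : #|` [fsetval y in Y]%fset| = #|Y|.
  rewrite card_imfset /=; last exact: val_inj.
  by rewrite cardE.
rewrite /fpowerset big_imfset /=; last first.
  move=> Y Z _ _ /fsetP YZ; apply/setP => y.
  have := YZ (val y); rewrite !in_fset_val /=.
  by case: insubP => //= [u _ /val_inj ->//|]; rewrite (valP y).
under eq_bigr do rewrite cardY.
rewrite big_enum /= powersetT.
rewrite (partition_big (fun Y : {set eta} => inord #|Y| : 'I_#|` eta|.+1)
  predT)//=.
apply: eq_bigr => j _.
have cardj (Y : {set eta}) : (inord #|Y| == j) = (#|Y| == j :> nat).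
  rewrite -val_eqE /= inordK// ltnS.
  by rewrite (leq_trans (max_card _))// cardfE.
under eq_bigl do rewrite inE cardj.
rewrite (eq_bigr (fun=> F j)); last by move=> Y /eqP ->.
rewrite sumr_const; congr (_ *+ _).
rewrite [X in 'C(X, _)]cardfE -card_draws.
by apply: eq_card => Y; rewrite !inE.
Qed.

Section Weights.
Context (R : realType).
Implicit Types (C delta : R) (n j : nat).

Lemma powR_fact_mul_le delta1 delta2 n j : (j <= n)%N ->
  0 <= delta1 -> 0 <= delta2 ->
  j`!%:R `^ delta1 * (n - j)`!%:R `^ delta2 <=
  (j`! * (n - j)`!)%:R `^ Num.max delta1 delta2 :> R.
Proof.
move=> jn d1 d2; rewrite natrM powRM//.
by apply: ler_pM; rewrite ?powR_ge0// ler_powR ?le_max ?lexx ?orbT//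
  ler1n fact_gt0.
Qed.

Lemma powR_fact_mul_le_fact delta1 delta2 n j : (j <= n)%N ->
  0 <= delta1 -> 0 <= delta2 ->
  j`!%:R `^ delta1 * (n - j)`!%:R `^ delta2 <=
  n`!%:R `^ Num.max delta1 delta2 :> R.
Proof.
move=> jn d1 d2; apply: le_trans (powR_fact_mul_le jn d1 d2) _.
apply: ge0_ler_powR; rewrite ?nnegrE ?le_max ?d1// ler_nat.
by rewrite -(bin_fact jn) leq_pmull// bin_gt0.
Qed.

(** An exponent at least 1 leaves room for the binomial coefficient, since
    j! (n - j)! binom(n, j) = n!. *)
Lemma powR_fact_mul_bin_le delta1 delta2 n j : (j <= n)%N ->
  0 <= delta1 -> 0 <= delta2 -> 1 <= Num.max delta1 delta2 ->
  (j`!%:R `^ delta1 * (n - j)`!%:R `^ delta2) *+ 'C(n, j) <=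
  n`!%:R `^ Num.max delta1 delta2 :> R.
Proof.
move=> jn d1 d2 d.
have := lerMn2r 'C(n, j) (j`!%:R `^ delta1 * (n - j)`!%:R `^ delta2)
  ((j`! * (n - j)`!)%:R `^ Num.max delta1 delta2).
rewrite powR_fact_mul_le// orbT => /le_trans; apply.
rewrite -(bin_fact jn) [X in _ <= X `^ _]natrM.
by rewrite -[leLHS]mulr_natl le1r_powRZ ?ler1n ?bin_gt0 ?ler0n.
Qed.

Lemma K_weight_gt0 (X : ptopologicalType) C delta (eta : Gamma0 X) :
  0 < C -> 0 < K_weight C delta eta.
Proof.
by move=> C0; rewrite mulr_gt0 ?exprn_gt0// powR_gt0// ltr0n fact_gt0.
Qed.

Lemma star_K_weight (X : ptopologicalType) C1 delta1 C2 delta2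
    (eta : Gamma0 X) (n := #|` eta|) :
  star_convolution (K_weight C1 delta1) (K_weight C2 delta2) eta =
  \sum_(j < n.+1) C1 ^+ j * C2 ^+ (n - j) *
    ((j`!%:R `^ delta1 * (n - j)`!%:R `^ delta2) *+ 'C(n, j)).
Proof.
pose F j := C1 ^+ j * C2 ^+ (n - j) *
  (j`!%:R `^ delta1 * (n - j)`!%:R `^ delta2).
transitivity (\sum_(xi <- fpowerset eta) F #|` xi|).
  rewrite /star_convolution big_seq [RHS]big_seq; apply: eq_bigr => xi.
  rewrite fpowersetE => xieta.
  by rewrite /K_weight /F cardfsDS// mulrACA.
by rewrite sum_fpowerset_card; apply: eq_bigr => j _; rewrite mulrnAr.
Qed.

Lemma star_K_weight_le (X : ptopologicalType) C1 delta1 C2 delta2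
    (eta : Gamma0 X) :
  0 <= C1 -> 0 <= C2 -> 0 <= delta1 -> 0 <= delta2 ->
  star_convolution (K_weight C1 delta1) (K_weight C2 delta2) eta <=
  K_weight (C1 + C2) (Num.max delta1 delta2) eta.
Proof.
move=> C10 C20 d1 d2; rewrite star_K_weight /K_weight addrC exprDn mulr_suml.
apply: ler_sum => j _; rewrite mulrnAr mulrnAl lerMn2r; apply/orP; right.
rewrite [C2 ^+ _ * _]mulrC ler_wpM2l ?mulr_ge0 ?exprn_ge0//.
by rewrite powR_fact_mul_le_fact// -ltnS.
Qed.

Lemma star_K_weight_le_sum (X : ptopologicalType) C1 delta1 C2 delta2
    (eta : Gamma0 X) (n := #|` eta|) :
  0 <= C1 -> 0 <= C2 -> 0 <= delta1 -> 0 <= delta2 ->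
  1 <= Num.max delta1 delta2 ->
  star_convolution (K_weight C1 delta1) (K_weight C2 delta2) eta <=
  (\sum_(j < n.+1) C1 ^+ j * C2 ^+ (n - j)) *
    n`!%:R `^ Num.max delta1 delta2.
Proof.
move=> C10 C20 d1 d2 d; rewrite star_K_weight mulr_suml.
apply: ler_sum => j _; rewrite ler_wpM2l ?mulr_ge0 ?exprn_ge0//.
by rewrite powR_fact_mul_bin_le// -ltnS.
Qed.

Lemma sum_expr_le C1 C2 n : 0 <= C1 -> 0 <= C2 -> C1 != C2 ->
  \sum_(j < n.+1) C1 ^+ j * C2 ^+ (n - j) <=
  Num.max C1 C2 / `|C1 - C2| * Num.max C1 C2 ^+ n.
Proof.
move=> C10 C20 C12.
have N0 : 0 < `|C1 - C2| by rewrite normr_gt0 subr_eq0.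
rewrite mulrAC ler_pdivlMr// -exprS.
have := subrXX C2 C1 n.+1; rewrite /=.
under eq_bigr do rewrite mulrC.
set S := \sum_(_ < _) _ => E.
have C1n : 0 <= C1 ^+ n.+1 by exact: exprn_ge0.
have C2n : 0 <= C2 ^+ n.+1 by exact: exprn_ge0.
by move: C12; case: (ltrgtP C1 C2) => // C12 _; lra.
Qed.

(** This is x <= e ^ (x - 1) at x = (n + 1) ln (C' / C). *)
Lemma succ_expr_le C C' n : 0 < C -> C < C' ->
  n.+1%:R * C ^+ n <= C' / (expR 1 * C * ln (C' / C)) * C' ^+ n.
Proof.
move=> C0 CC'; have C'0 : 0 < C' by exact: lt_trans CC'.
have a1 : 1 < C' / C by rewrite ltr_pdivlMr// mul1r.
have l0 : 0 < ln (C' / C) by exact: ln_gt0.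
have e0 : 0 < expR 1 :> R by exact: expR_gt0.
rewrite mulrAC ler_pdivlMr ?mulr_gt0// -exprS.
have := expR_ge1Dx (ln (C' / C) * n.+1%:R - 1).
rewrite addrC subrK expRD expRM_natr lnK ?posrE ?divr_gt0// expRN.
rewrite ler_pdivlMr// expr_div_n ler_pdivlMr ?exprn_gt0//.
by apply: le_trans; rewrite exprS le_eqVlt; apply/orP; left; apply/eqP; ring.
Qed.

(** This is B ^ n / n! <= e ^ B at B = A ^ (1 / delta), raised to the power
    delta. *)
Lemma expr_le_fact_powR (A delta : R) n : 0 < A -> 0 < delta ->
  A ^+ n <= expR (A `^ delta^-1) `^ delta * n`!%:R `^ delta.
Proof.
move=> A0 d0; set B := A `^ delta^-1.
have B0 : 0 <= B by exact: powR_ge0.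
have BA : A = B `^ delta by rewrite -powRrM mulVf ?gt_eqF// powRr1// ltW.
have Bn : B ^+ n <= expR B * n`!%:R.
  case: n => [|n]; first by rewrite expr0 fact0 mulr1 -expR0 ler_expR.
  rewrite -ler_pdivrMr ?ltr0n ?fact_gt0//.
  by have := expR_ge1Dxn n B0; apply: le_trans; rewrite lerDr.
clearbody B; rewrite -powRM ?expR_ge0//.
have -> : A ^+ n = (B ^+ n) `^ delta.
  by rewrite [in LHS]BA -(powR_mulrn n (powR_ge0 _ _))
    -(powR_mulrn n B0) -!powRrM mulrC.
apply: ge0_ler_powR => //; first exact: ltW.
- by rewrite nnegrE exprn_ge0.
- by rewrite nnegrE mulr_ge0 ?expR_ge0.
Qed.

End Weights.

(** * The Borel structure of the configuration space *)

Section TupleTopology.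
Context (X : ptopologicalType).

Lemma continuous_tuple (T : topologicalType) n (f : T -> n.-tuple X) :
  (forall i, continuous (fun x => tnth (f x) i)) -> continuous f.
Proof.
move=> cf x A; rewrite nbhsE => -[W [oW Wfx] WA].
have [V [Vf VW]] := open_tuple_box oW Wfx.
have : \forall y \near x, forall i, V i (tnth (f y) i).
  by apply: filter_forall => i; exact: (cf i x _ (open_nbhs_nbhs (Vf i))).
by apply: filterS => y Vy; apply/WA/VW.
Qed.

Lemma open_box n (V : 'I_n -> set X) : (forall i, open (V i)) ->
  open [set s : n.-tuple X | forall i, V i (tnth s i)].
Proof.
move=> oV; rewrite openE => s Vs.
apply: (@filter_forall _ _ (fun i (u : n.-tuple X) => V i (tnth u i)) (nbhs s)).
move=> i; apply: (@tnth_continuous X n i s).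
exact: open_nbhs_nbhs.
Qed.

(** A countable basis of X yields a countable basis of its powers, indexed by
    tuples of codes; the codes of non-open boxes stand for the empty set. *)
Lemma tuple_countable_basis n : second_countable (T := X) ->
  exists U : n.-tuple nat -> set (n.-tuple X), (forall c, open (U c)) /\
    forall O t, open O -> O t -> exists c, U c t /\ U c `<=` O.
Proof.
move=> [B /countable_injP[f finj] [Bo Bb]].
pose e k := get [set b | B b /\ f b = k].
have eB b : B b -> e (f b) = b.
  move=> Bb'; have [|Be fe] := @getPex _ [set c | B c /\ f c = f b].
    by exists b.
  by apply: finj => //; exact/mem_set.
pose box (c : n.-tuple nat) : set (n.-tuple X) :=
  [set s | forall i, e (tnth c i) (tnth s i)].
pose ok (c : n.-tuple nat) := forall i, open (e (tnth c i)).
exists (fun c => if `[< ok c >] then box c else set0); split.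
  move=> c; case: asboolP => [okc|_]; last exact: open0.
  exact: (open_box okc).
move=> O t oO Ot; have [V [Vo VO]] := open_tuple_box oO Ot.
have Ub i : exists b, [/\ B b, b (tnth t i) & b `<=` V i].
  have [|U [BU Ut] UV] := Bb (tnth t i) (V i).
    exact: open_nbhs_nbhs (Vo i).
  by exists U.
have [b bP] := choice Ub.
have eb i : e (tnth [tuple f (b i) | i < n] i) = b i.
  by rewrite tnth_mktuple eB//; have [] := bP i.
exists [tuple f (b i) | i < n]; rewrite asboolT; last first.
  by move=> i; rewrite eb; have [/Bo] := bP i.
split=> [i|s sb]; first by rewrite eb; have [] := bP i.
by apply: VO => i; have [_ _] := bP i; apply; have := sb i; rewrite eb.
Qed.

(** The product sigma-algebra is contained in the Borel one. *)
Lemma measurable_tuple_borel n (A : set (n.-tuple (borel X))) :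
  measurable A -> measurable (A : set (borel (n.-tuple X))).
Proof.
move=> mA.
have : measurable_fun [set: borel (n.-tuple X)]
    (id : borel (n.-tuple X) -> n.-tuple (borel X)).
  apply/measurable_fun_tnthP => i.
  apply: (@measurability _ _ (borel (n.-tuple X)) (borel X) _ _ (@open X))
    => //.
  move=> _ [W oW <-]; rewrite setTI.
  apply: sub_sigma_algebra.
  exact: (proj1 (continuousP _) (@tnth_continuous X n i)).
by move=> /(_ measurableT A mA); rewrite setTI.
Qed.

End TupleTopology.

Section Quotient.
Context (X : ptopologicalType).
Hypothesis X2 : second_countable (T := X).
Hypothesis XT2 : hausdorff_space X.

Lemma card_tuple_set_uniq n (t : n.-tuple X) :
  distinct_tuples n X t -> #|` tuple_set t| = n.
Proof.
by move=> ut; rewrite /tuple_set card_fseq undup_id// size_tuple.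
Qed.

(** No injectivity of the reindexing map is required: it follows from the
    distinctness of the entries. *)
Lemma tuple_set_rearrange n (s t : n.-tuple X) :
  distinct_tuples n X t -> distinct_tuples n X s ->
  (tuple_set t = tuple_set s <->
   exists e : 'I_n -> 'I_n, s = [tuple tnth t (e i) | i < n]).
Proof.
move=> ut us; split=> [ts|[e se]].
  have ex i : exists j, tnth s i = tnth t j.
    have : tnth s i \in tuple_set t by rewrite ts !inE mem_tnth.
    by rewrite !inE => /tnthP.
  have [e eP] := choice ex.
  by exists e; apply: eq_from_tnth => i; rewrite tnth_mktuple.
apply/esym/eqP; rewrite eqEfcard !card_tuple_set_uniq// leqnn andbT.
apply/fsubsetP => x; rewrite !inE => /tnthP[i ->].
by rewrite se tnth_mktuple mem_tnth.
Qed.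

(** The projection to configurations is an open map: the saturation of an open
    set is the union of its preimages under the reindexings of coordinates. *)
Lemma open_tuple_set_image n (O : set (n.-tuple X)) :
  open O -> O `<=` distinct_tuples n X ->
  open (@tuple_set n X @` O : set (Gamma0 X)).
Proof.
move=> oO OD; rewrite -[open _]/(Gamma0_open _) => k.
have [<-|nk] := eqVneq n k; last first.
  rewrite (_ : [set _ | _] = set0); first exact: open0.
  apply/seteqP; split => // -[eta etak] /= [t Ot teta].
  by move: nk; rewrite -(card_tuple_set_uniq (OD _ Ot)) teta etak.
exists (\bigcup_(e : 'I_n -> 'I_n)
    (fun t : n.-tuple X => [tuple tnth t (e i) | i < n]) @^-1` O).
  apply: bigcup_open => e _.
  apply: (proj1 (continuousP _)) => //; apply: continuous_tuple => i.
  rewrite (_ : (fun _ => _) = (@tnth n X)^~ (e i)).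
    exact: tnth_continuous.
  by apply/funext => t; rewrite tnth_mktuple.
apply/seteqP; split => t /=.
  move=> [e _ Ot]; exists [tuple tnth (set_val t) (e i) | i < n] => //.
  apply/esym/tuple_set_rearrange; [exact: set_valP|exact: OD|by exists e].
move=> [s Os st].
have ut : distinct_tuples n X (set_val t) by exact: set_valP.
have [e se] := proj1 (tuple_set_rearrange ut (OD _ Os)) (esym st).
by exists e => //=; rewrite -se.
Qed.

(** By separation, the entries of t have pairwise disjoint neighbourhoods, and
    the projection is injective on the box that they form. *)
Lemma distinct_tuple_nbhs n (t : n.-tuple X) : distinct_tuples n X t ->
  exists V : set (n.-tuple X), [/\ open V, V t, V `<=` distinct_tuples n X &
    {in V &, injective (@tuple_set n X)}].
Proof.
move=> ut.
have sep (ij : 'I_n * 'I_n) : exists AB : set X * set X,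
    [/\ open AB.1, open AB.2, AB.1 (tnth t ij.1), AB.2 (tnth t ij.2) &
      ij.1 != ij.2 -> AB.1 `&` AB.2 = set0].
  have [->|ij1] := eqVneq ij.1 ij.2.
    by exists (setT, setT); split => //; exact: openT.
  have : tnth t ij.1 != tnth t ij.2.
    by apply: contra_neq ij1; exact: (tuple_uniqP t ut).
  move: XT2; rewrite open_hausdorff => H /H[[A B] /= [At Bt] [oA oB /eqP AB0]].
  by exists (A, B); split => //; exact/set_mem.
have [AB ABP] := choice sep.
pose W i j := (AB (i, j)).1 `&` (AB (j, i)).2.
have oW i j : open (W i j).
  by apply: openI; [have [] := ABP (i, j)|have [] := ABP (j, i)].
have Wt i j : W i j (tnth t i).
  by split; [have [] := ABP (i, j)|have [] := ABP (j, i)].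
have W0 i j x : i != j -> W i j x -> ~ W j i x.
  move=> ij [ABij _] [_ ABij'].
  have [_ _ _ _ /(_ ij)] := ABP (i, j).
  by move/seteqP => [/(_ x) + _]; apply.
pose V := [set s : n.-tuple X | forall i j, W i j (tnth s i)].
have VD : V `<=` distinct_tuples n X.
  move=> s Vs; apply/tuple_uniqP => i j sij; apply/eqP/negPn/negP => ij.
  have Wij : W i j (tnth s i) by exact: Vs.
  by have := Vs j i; rewrite -sij => /(W0 _ _ _ ij Wij).
exists V; split => //.
  rewrite openE => s Vs.
  apply: (@filter_forall _ _
    (fun i (u : n.-tuple X) => forall j, W i j (tnth u i)) (nbhs s)) => i.
  apply: (@filter_forall _ _
    (fun j (u : n.-tuple X) => W i j (tnth u i)) (nbhs s)) => j.
  apply: (@tnth_continuous X n i s); apply: open_nbhs_nbhs.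
  by split => //; exact: Vs.
move=> s s' /set_mem Vs /set_mem Vs' ss'; apply: eq_from_tnth => i.
have : tnth s i \in tuple_set s' by rewrite -ss' !inE mem_tnth.
rewrite !inE => /tnthP[j sj].
have [ij|ij] := eqVneq i j; first by rewrite sj ij.
have Wij : W i j (tnth s i) by exact: Vs.
by have := Vs' j i; rewrite -sj => /(W0 _ _ _ ij Wij).
Qed.

(** Injectivity makes the sets with Borel image stable under complement, and
    openness of the projection puts the open sets among them. *)
Lemma measurable_image_tuple_set n (V S : set (n.-tuple X)) :
  open V -> V `<=` distinct_tuples n X ->
  {in V &, injective (@tuple_set n X)} ->
  measurable (S : set (n.-tuple (borel X))) ->
  measurable (@tuple_set n X @` (V `&` S) : set (borel (Gamma0 X))).
Proof.
move=> oV VD Vinj /measurable_tuple_borel; move: S.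
pose Q : set (set (borel (n.-tuple X))) := [set S |
  measurable (@tuple_set n X @` (V `&` S) : set (borel (Gamma0 X)))].
suff : (measurable : set (set (borel (n.-tuple X)))) `<=` Q by exact.
have mO O : open O ->
    measurable (@tuple_set n X @` (V `&` O) : set (borel (Gamma0 X))).
  move=> oO; apply: sub_sigma_algebra; apply: open_tuple_set_image.
    exact: openI.
  by move=> t [/VD].
apply: smallest_sub => //; split; rewrite /Q /=.
- by rewrite setI0 image_set0.
- move=> S mS; rewrite setTD.
  rewrite (_ : _ @` (V `&` ~` S) =
      (@tuple_set n X @` (V `&` setT)) `\` (@tuple_set n X @` (V `&` S))).
    by apply: measurableD => //; apply: mO; exact: openT.
  rewrite setIT; apply/seteqP; split => [_ [t [Vt St] <-]|_ [[t Vt <-] tS]].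
    split; first by exists t.
    move=> [s [Vs Ss]] st; apply: St.
    by rewrite -(Vinj s t)//; exact/mem_set.
  by exists t => //; split => // St; apply: tS; exists t.
- move=> F mF; rewrite setI_bigcupr image_bigcup.
  exact: bigcupT_measurable.
Qed.

(** The converse of [distinct_preimage_measurable]. *)
Lemma measurable_Gamma0 (A : set (borel (Gamma0 X))) :
  (forall n, measurable (distinct_tuples n X `&` @tuple_set n X @^-1` A
     : set (n.-tuple (borel X)))) ->
  measurable A.
Proof.
move=> mA.
have AE : A = \bigcup_n @tuple_set n X @` (distinct_tuples n X `&`
    @tuple_set n X @^-1` A).
  apply/seteqP; split => [eta Aeta|_ [n _ [t [_ At] <-]]//].
  have etaE : tuple_set (in_tuple eta) = eta.
    by apply/fsetP => x; rewrite inE.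
  exists #|` eta| => //; exists (in_tuple eta) => //.
  by split; [exact: fset_uniq|rewrite /= etaE].
rewrite AE; apply: bigcupT_measurable => n.
have [U [oU bU]] := tuple_countable_basis n X2.
pose good (V : set (n.-tuple X)) := V `<=` distinct_tuples n X /\
  {in V &, injective (@tuple_set n X)}.
set S := (X in _ @` X).
have -> : @tuple_set n X @` S = \bigcup_(c : n.-tuple nat)
    (if `[< good (U c) >] then @tuple_set n X @` (U c `&` S) else set0).
  apply/seteqP; split => [_ [t [ut At] <-]|eta [c _]]; last first.
    by case: asboolP => // _ [t [_ St] <-]; exists t.
  have [V [oV Vt VD Vinj]] := distinct_tuple_nbhs ut.
  have [c [Uct UcV]] := bU V t oV Vt.
  exists c => //; rewrite asboolT; first by exists t.
  split; first exact: subset_trans VD.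
  by move=> x y /set_mem/UcV/mem_set xV /set_mem/UcV/mem_set yV; exact: Vinj.
apply: countable_bigcupT_measurable => // c.
case: asboolP => [[UD Uinj]|_]; last exact: measurable0.
exact: measurable_image_tuple_set.
Qed.

End Quotient.

(** * Erasing coordinates of a tuple *)

(** The subtuple of the entries selected by the bits of b, as a map between
    tuple types: its source has the length of b and its target the number of
    true bits. *)
Fixpoint tmask (T : Type) (b : bitseq) :
    (size b).-tuple T -> (count id b).-tuple T :=
  match b with
  | [::] => fun=> [tuple]
  | true :: b' => fun t => [tuple of thead t :: tmask [tuple of behead t]]
  | false :: b' => fun t => tmask [tuple of behead t]
  end.

Lemma val_tmask (T : Type) (b : bitseq) (t : (size b).-tuple T) :
  tmask t = mask b t :> seq T.
Proof.
elim: b t => [|[] b IH] t //=.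
  by rewrite IH; case/tupleP: t => x t; rewrite theadE.
by rewrite IH; case/tupleP: t => x t.
Qed.

Lemma measurable_tmask d (T : measurableType d) (b : bitseq) :
  measurable_fun setT (@tmask T b).
Proof.
elim: b => [|[] b IH] /=; first exact: measurable_cst.
  apply: measurable_cons; first exact: measurable_tnth.
  by apply: measurableT_comp => //; exact: measurable_behead.
by apply: measurableT_comp => //; exact: measurable_behead.
Qed.

Lemma behead_cons_tuple (T : Type) n (x : T) (t : n.-tuple T) :
  [tuple of behead [tuple of x :: t]] = t :> n.-tuple T.
Proof. exact: val_inj. Qed.

Section NullMask.
Local Open Scope ereal_scope.
Context d (T : measurableType d) (R : realType)
  (mu : {sigma_finite_measure set T -> \bar R}).

Let cons_section n (A : set (n.+1.-tuple T)) x : set (n.-tuple T) :=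
  [set t : n.-tuple T | A [tuple of x :: t]].

Let measurable_cons_preimage n (A : set (n.+1.-tuple T)) : measurable A ->
  measurable [set p : T * n.-tuple T | A [tuple of p.1 :: p.2]].
Proof.
move=> mA.
have : measurable_fun setT
    (fun p : T * n.-tuple T => [the n.+1.-tuple T of p.1 :: p.2]).
  by apply: measurable_cons.
by move=> /(_ measurableT A mA); rewrite setTI.
Qed.

Let cons_sectionE n (A : set (n.+1.-tuple T)) x :
  cons_section A x =
  xsection [set p : T * n.-tuple T | A [tuple of p.1 :: p.2]] x.
Proof. by rewrite xsectionE. Qed.

Let measurable_cons_section n (A : set (n.+1.-tuple T)) x :
  measurable A -> measurable (cons_section A x).
Proof.
move=> mA; rewrite cons_sectionE.
by apply: measurable_xsection; exact: measurable_cons_preimage.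
Qed.

(** A set of tuples is null iff almost all its sections along the first
    coordinate are. *)
Lemma tuple_measure_cons_eq0 n (A : set (n.+1.-tuple T)) : measurable A ->
  tuple_measure mu n.+1 A = 0 <->
  \forall x \ae mu,
    tuple_measure mu n [set t : n.-tuple T | A [tuple of x :: t]] = 0.
Proof.
move=> mA; set B := [set p : T * n.-tuple T | A [tuple of p.1 :: p.2]].
have mB : measurable B by exact: measurable_cons_preimage.
have mf := measurable_fun_xsection (tuple_measure mu n) mB.
have -> : tuple_measure mu n.+1 A =
    \int[mu]_x `|(tuple_measure mu n \o xsection B) x|.
  rewrite /= /cons_measure /pushforward /product_measure1.
  by apply: eq_integral => x _; rewrite gee0_abs.
rewrite ae_eq_integral_abs//.
split; apply: filterS => x /=; rewrite -cons_sectionE; first exact.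
by move=> + _.
Qed.

(** By induction on b: a kept coordinate is treated by sections on both sides,
    and all the sections along an erased coordinate coincide. *)
Lemma tmask_null (b : bitseq) (A : set ((count id b).-tuple T)) :
  measurable A -> tuple_measure mu (count id b) A = 0 ->
  tuple_measure mu (size b) (@tmask T b @^-1` A) = 0.
Proof.
elim: b A => [|[] b IH] A mA A0.
- rewrite -A0; congr (tuple_measure mu 0 _).
  by apply/seteqP; split => t; rewrite /= (tuple0 t).
- have mpA : measurable (@tmask T (true :: b) @^-1` A).
    by rewrite -[_ @^-1` _]setTI; exact: measurable_tmask.
  apply/(tuple_measure_cons_eq0 mpA).
  move/(tuple_measure_cons_eq0 mA) : A0; apply: filterS => x A0.
  rewrite -(IH _ _ A0); last exact: measurable_cons_section.
  congr (tuple_measure mu (size b) _).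
  apply/seteqP; split => t /=; rewrite theadE.
    by rewrite behead_cons_tuple.
  by rewrite behead_cons_tuple.
- have mpA : measurable (@tmask T (false :: b) @^-1` A).
    by rewrite -[_ @^-1` _]setTI; exact: measurable_tmask.
  apply/(tuple_measure_cons_eq0 mpA); apply: nearW => x.
  rewrite -(IH _ mA A0); congr (tuple_measure mu (size b) _).
  apply/seteqP; split => t /=.
    by rewrite behead_cons_tuple.
  by rewrite behead_cons_tuple.
Qed.

End NullMask.

(** * Subsets of a configuration and the convolution on tuples *)

Section Submask.
Context (X : choiceType).

(** The set of the entries of t selected by the bits of b. *)
Definition submask n (b : n.-tuple bool) (t : n.-tuple X) : {fset X} :=
  [fset x in mask b t]%fset.

Lemma submaskE n (b : n.-tuple bool) (t : n.-tuple X) (i : 'I_n) :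
  distinct_tuples n X t -> (tnth t i \in submask b t) = tnth b i.
Proof.
move=> ut; rewrite !inE in_mask// mem_tnth /=.
have x0 : X := tnth t i.
rewrite (tnth_nth x0) index_uniq// ?size_tuple//.
by rewrite (tnth_nth false).
Qed.

Lemma submask_inj n (t : n.-tuple X) : distinct_tuples n X t ->
  injective (fun b : n.-tuple bool => submask b t).
Proof.
move=> ut b b' bb'; apply: eq_from_tnth => i.
by rewrite -!(submaskE _ _ ut) bb'.
Qed.

Lemma fpowerset_tuple_set n (t : n.-tuple X) :
  fpowerset (tuple_set t) =
  [fset submask b t | b in [set: n.-tuple bool]%SET]%fset.
Proof.
apply/fsetP => xi; rewrite fpowersetE; apply/idP/imfsetP => [/fsubsetP xit|].
  exists [tuple of [seq x \in xi | x <- t]]; first by rewrite !inE.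
  rewrite /submask /= -filter_mask; apply/fsetP => x.
  rewrite !inE mem_filter; case: (boolP (x \in xi)) => //= /xit.
  by rewrite !inE => ->.
move=> [b _ ->]; apply/fsubsetP => x; rewrite !inE; exact: mem_mask.
Qed.

Lemma tuple_setD_submask n (b : n.-tuple bool) (t : n.-tuple X) :
  distinct_tuples n X t ->
  (tuple_set t `\` submask b t)%fset = submask [tuple of map negb b] t.
Proof.
move=> ut; apply/fsetP => x; rewrite !inE /= !in_mask//.
case: (boolP (x \in tval t)) => //= xt; rewrite ?andbF// andbT.
by rewrite (nth_map false)// size_tuple -{2}(size_tuple t) index_mem.
Qed.

(** The subsets of {x_1, .., x_n} are indexed by the bit tuples of length n. *)
Lemma star_tuple_set (R : realType) (k1 k2 : Gamma0 X -> R) n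
    (t : n.-tuple X) : distinct_tuples n X t ->
  star_convolution k1 k2 (tuple_set t) =
  \sum_(b <- enum [set: n.-tuple bool]%SET)
    k1 (submask b t) * k2 (submask [tuple of map negb b] t).
Proof.
move=> ut; rewrite /star_convolution fpowerset_tuple_set big_imfset /=.
  by apply: eq_bigr => b _; rewrite tuple_setD_submask.
by move=> b b' _ _; exact: submask_inj.
Qed.

End Submask.

Section SubmaskMeasurable.
Context (X : ptopologicalType).
Hypothesis X2 : second_countable (T := X).
Hypothesis XT2 : hausdorff_space X.

Lemma measurable_submask n (b : n.-tuple bool) (A : set (borel (Gamma0 X))) :
  measurable A ->
  measurable (distinct_tuples n X `&` submask b @^-1` A
    : set (n.-tuple (borel X))).
Proof.
move=> mA; rewrite /submask; have := size_tuple b.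
move: (tval b) => {}b bn; subst n.
rewrite (_ : _ `&` _ = distinct_tuples (size b) X `&` @tmask X b @^-1`
  (distinct_tuples (count id b) X `&` @tuple_set _ X @^-1` A)).
  apply: measurableI; first exact: distinct_tuples_measurable.
  rewrite -[X in measurable X]setTI; apply: measurable_tmask => //.
  exact: distinct_preimage_measurable.
apply/seteqP; split => t [ut /=]; rewrite /tuple_set /= val_tmask.
  move=> At; split => //; split => //.
  by rewrite /distinct_tuples /= val_tmask; exact: mask_uniq.
by move=> [_ At].
Qed.

Lemma measurable_star (R : realType) (k1 k2 : borel (Gamma0 X) -> R) :
  measurable_fun setT k1 -> measurable_fun setT k2 ->
  measurable_fun setT
    (star_convolution k1 k2 : borel (Gamma0 X) -> R).
Proof.
move=> mk1 mk2 _ Y mY; rewrite setTI; apply: (measurable_Gamma0 X2 XT2) => n.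
have mD := @distinct_tuples_measurable X X2 XT2 n.
have msub (b : n.-tuple bool) (k : borel (Gamma0 X) -> R) :
    measurable_fun setT k ->
    measurable_fun (distinct_tuples n X : set (n.-tuple (borel X)))
      (fun t : n.-tuple (borel X) => k (submask b t)).
  move=> mk _ Z mZ; have mkZ : measurable (k @^-1` Z).
    by rewrite -[_ @^-1` _]setTI; exact: mk.
  exact: (measurable_submask b mkZ).
have : measurable_fun (distinct_tuples n X : set (n.-tuple (borel X)))
    (fun t : n.-tuple (borel X) => star_convolution k1 k2 (tuple_set t)).
  apply: (eq_measurable_fun (fun t : n.-tuple (borel X) =>
      \sum_(b <- enum [set: n.-tuple bool]%SET)
      k1 (submask b t) * k2 (submask [tuple of map negb b] t))).
    by move=> t /set_mem ut; rewrite -star_tuple_set.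
  apply: measurable_sum => b.
  by apply: measurable_realfun.measurable_funM; exact: msub.
by move=> /(_ mD Y mY).
Qed.

(** The configurations with some subset in N, seen on tuples. *)
Lemma superset_preimageE n (N : set (Gamma0 X)) :
  distinct_tuples n X `&` @tuple_set n X @^-1`
    [set eta | exists2 xi : {fset X}, (xi `<=` eta)%fset & N xi] =
  \bigcup_(b : n.-tuple bool) (distinct_tuples n X `&` submask b @^-1` N).
Proof.
apply/seteqP; split => [t [ut /= [xi]]|t [b _ [ut /= Nb]]].
  rewrite -fpowersetE fpowerset_tuple_set => /imfsetP[b /= _ ->] Nb.
  by exists b.
split => //; exists (submask b t) => //.
rewrite -fpowersetE fpowerset_tuple_set; apply/imfsetP.
by exists b => //=; rewrite inE.
Qed.

Lemma measurable_superset (N : set (borel (Gamma0 X))) : measurable N ->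
  measurable ([set eta | exists2 xi : {fset X}, (xi `<=` eta)%fset & N xi]
    : set (borel (Gamma0 X))).
Proof.
move=> mN; apply: (measurable_Gamma0 X2 XT2) => n; rewrite superset_preimageE.
apply: countable_bigcupT_measurable => // b; exact: measurable_submask.
Qed.

Lemma submask_null (R : realType)
    (mu : {sigma_finite_measure set (borel X) -> \bar R}) n
    (b : n.-tuple bool) (A : set (borel (Gamma0 X))) : measurable A ->
  (forall k, tuple_measure mu k
     (distinct_tuples k X `&` @tuple_set k X @^-1` A) = 0%E) ->
  tuple_measure mu n (distinct_tuples n X `&` submask b @^-1` A) = 0%E.
Proof.
move=> mA A0; have := measurable_submask b mA.
rewrite /submask; have := size_tuple b.
move: (tval b) => {}b bn; subst n => mbA.
have mA' := @distinct_preimage_measurable X X2 XT2 (count id b) A mA.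
apply: (@subset_measure0 _ _ _ (tuple_measure mu (size b)) _
  (@tmask X b @^-1` (distinct_tuples (count id b) X `&`
    @tuple_set _ X @^-1` A))) => //.
- by rewrite -[X in measurable X]setTI; exact: measurable_tmask.
- move=> t [ut At]; split.
    by rewrite /distinct_tuples /= val_tmask; exact: mask_uniq.
  by rewrite /= /tuple_set val_tmask.
- by apply: (@tmask_null _ (borel X) R mu b) => //; exact: A0.
Qed.

End SubmaskMeasurable.

(** * Almost sure properties of finite configurations *)

Section AlmostEverywhere.
Context (R : realType) (d : nat) (X : oriented_riemannian_manifold R d)
  (m : nonatomic_radon R X).

Lemma lebesgue_poisson_eq0 (A : set (borel (Gamma0 X))) :
  lebesgue_poisson m A = 0%E <-> forall n, Gamma_measure m n A = 0%E.
Proof.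
pose a n : \bar R := ((n`!%:R^-1)%:E * Gamma_measure m n A)%E.
have a0 n : (0 <= a n)%E.
  by rewrite mule_ge0 ?lee_fin ?invr_ge0//; exact: measure_ge0.
rewrite (_ : lebesgue_poisson m A = (\sum_(0 <= n <oo) a n)%E)//.
split=> [A0 n|A0]; last first.
  by apply: eseries0 => n _ _; rewrite /a A0 mule0.
have /eqP : a n = 0%E.
  apply/eqP; rewrite eq_le a0 andbT -A0 (@nneseriesD1 _ _ n)//.
  by rewrite leeDl// nneseries_ge0.
rewrite mule_eq0 => /orP[|/eqP//].
by rewrite eqe invr_eq0 pnatr_eq0 -leqn0 leqNgt fact_gt0.
Qed.

(** If N is a null set off which P holds, then the configurations with a subset
    in N form a null set. *)
Lemma ae_forall_subset (P : set (Gamma0 X)) :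
  (\forall eta \ae lebesgue_poisson m, P eta) ->
  \forall eta \ae lebesgue_poisson m,
    forall xi : {fset X}, (xi `<=` eta)%fset -> P xi.
Proof.
have X2 := mfd_second_countable X; have XT2 := @mfd_hausdorff _ _ X.
move=> [N [mN N0 PN]].
have mS := measurable_superset X2 XT2 mN.
exists [set eta | exists2 xi : {fset X}, (xi `<=` eta)%fset & N xi].
split => //.
  apply/lebesgue_poisson_eq0 => n.
  rewrite /Gamma_measure superset_preimageE.
  have mb (b : n.-tuple bool) := measurable_submask X2 XT2 b mN.
  apply/negligibleP; first by apply: countable_bigcupT_measurable.
  pose F k : set (n.-tuple (borel X)) :=
    if (choice.unpickle k : option (n.-tuple bool)) is Some b then
    distinct_tuples n X `&` @submask X n b @^-1` N else set0.
  apply: (@negligibleS _ _ _ (tuple_measure (intensity m) n) (\bigcup_k F k)).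
    move=> t [b _ bt]; exists (choice.pickle b) => //.
    by rewrite /F choice.pickleK.
  apply: negligible_bigcup => k; rewrite /F.
  case: choice.unpickle => [b|]; last exact: negligible_set0.
  apply/negligibleP => //; apply: submask_null => // k'.
  by move/lebesgue_poisson_eq0 : N0; apply.
move=> eta /= /existsNP[xi] /not_implyP[xieta Pxi].
by exists xi => //; exact: PN.
Qed.

(** The empty configuration is an atom. *)
Lemma lebesgue_poisson_gt0 : (0 < lebesgue_poisson m [set: borel (Gamma0 X)])%E.
Proof.
rewrite lt0e measure_ge0 andbT; apply/eqP => /lebesgue_poisson_eq0 /(_ 0%N).
rewrite /Gamma_measure /= diracE mem_set; last first.
  by split.
by move/eqP; rewrite onee_eq0.
Qed.

End AlmostEverywhere.

(** * The norm estimate for the convolution *)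

Section StarBound.
Context (R : realType) (d : nat) (X : oriented_riemannian_manifold R d)
  (m : nonatomic_radon R X).
Let lambda := lebesgue_poisson m.
Implicit Types (C delta c : R) (k : borel (Gamma0 X) -> R).

Lemma K_normP C delta k (M : R) : 0 < C ->
  (K_norm lambda C delta k <= M%:E)%E <->
  \forall eta \ae lambda, `|k eta| <= M * K_weight C delta eta.
Proof.
move=> C0.
have E eta : (`|k eta| / K_weight C delta eta <= M) =
    (`|k eta| <= M * K_weight C delta eta).
  by rewrite ler_pdivrMr// K_weight_gt0.
split=> [/ess_supP|kM]; last (apply/ess_supP; move: kM);
  by apply: filterS => eta; rewrite lee_fin E.
Qed.

Lemma K_norm_ge0 C delta k : 0 < C -> (0 <= K_norm lambda C delta k)%E.
Proof.
move=> C0; apply: ess_sup_ger; first exact: lebesgue_poisson_gt0.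
by move=> eta; rewrite lee_fin divr_ge0// ltW// K_weight_gt0.
Qed.

Lemma K_norm_fin_num C delta k : 0 < C -> K_space lambda C delta k ->
  K_norm lambda C delta k \is a fin_num.
Proof.
move=> C0 [_ [M /(K_normP _ _ _ C0) kM]].
by rewrite ge0_fin_numE ?K_norm_ge0// (le_lt_trans kM)// ltry.
Qed.

Lemma K_norm_ae C delta k : 0 < C -> K_space lambda C delta k ->
  \forall eta \ae lambda,
    `|k eta| <= fine (K_norm lambda C delta k) * K_weight C delta eta.
Proof.
by move=> C0 kK; apply/K_normP => //; rewrite fineK// K_norm_fin_num.
Qed.

(** The general estimate: a pointwise bound on the convolution of the weights
    gives the bound on the norm of the convolution. *)
Lemma star_bound C1 delta1 C2 delta2 C delta c k1 k2 :
  0 < C1 -> 0 < C2 -> 0 < C ->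
  (forall eta : Gamma0 X,
    star_convolution (K_weight C1 delta1) (K_weight C2 delta2) eta <=
    c * K_weight C delta eta) ->
  K_space lambda C1 delta1 k1 -> K_space lambda C2 delta2 k2 ->
  K_space lambda C delta (star_convolution k1 k2) /\
  (K_norm lambda C delta (star_convolution k1 k2) <=
    c%:E * (K_norm lambda C1 delta1 k1 * K_norm lambda C2 delta2 k2))%E.
Proof.
move=> C10 C20 C0 wc k1K k2K.
have M10 := fine_ge0 (K_norm_ge0 delta1 k1 C10).
have M20 := fine_ge0 (K_norm_ge0 delta2 k2 C20).
set M1 := fine _ in M10; set M2 := fine _ in M20.
have bound : \forall eta \ae lambda,
    `|(star_convolution k1 k2 : borel (Gamma0 X) -> R) eta| <=
    c * (M1 * M2) * K_weight C delta eta.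
  have aeF : Filter (almost_everywhere lambda).
    exact: ae_filter_ringOfSetsType.
  have := ae_forall_subset (K_norm_ae C20 k2K).
  have := ae_forall_subset (K_norm_ae C10 k1K).
  apply: (@filterS2 _ _ aeF) => eta k1M k2M.
  rewrite (mulrC c) -mulrA.
  apply: le_trans (ler_wpM2l (mulr_ge0 M10 M20) (wc eta)).
  rewrite /star_convolution mulr_sumr; apply: le_trans (ler_norm_sum _ _ _) _.
  rewrite big_seq [leRHS]big_seq; apply: ler_sum => xi.
  rewrite fpowersetE => xieta; rewrite normrM mulrACA.
  by apply: ler_pM => //; [exact: k1M|apply: k2M; exact: fsubsetDl].
split.
  split; last by exists (c * (M1 * M2)).
  apply: measurable_star; [exact: mfd_second_countable|exact: mfd_hausdorff|
    by case: k1K|by case: k2K].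
rewrite -(fineK (K_norm_fin_num C10 k1K)) -(fineK (K_norm_fin_num C20 k2K)).
by rewrite -!EFinM; exact/K_normP.
Qed.

Lemma K_weight10 (eta : Gamma0 X) : K_weight (1 : R) 0 eta = 1.
Proof. by rewrite /K_weight expr1n powRr0 mulr1. Qed.

Lemma K_norm10 k : K_norm lambda 1 0 k = 'N[lambda]_+oo[EFin \o k]%E.
Proof.
rewrite unlock /Lnorm lebesgue_poisson_gt0 /K_norm.
by congr (ess_sup _ _); apply/funext => eta; rewrite K_weight10 divr1.
Qed.

Lemma Lfun_K_space k : k \in Lfun lambda +oo%E -> K_space lambda 1 0 k.
Proof.
move=> kL; have mk : measurable_fun setT k.
  by have := sub_Lfun_mfun kL; rewrite inE.
have koo : ('N[lambda]_+oo[EFin \o k] < +oo)%E.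
  by have := sub_Lfun_finLfun kL; rewrite inE.
split => //; exists (fine (K_norm lambda 1 0 k)).
apply/K_normP => //; rewrite fineK// ge0_fin_numE ?K_norm_ge0//.
by rewrite K_norm10.
Qed.

End StarBound.

(** * Conclusion *)

Theorem proposition3p3 (R : realType) (d : nat)
    (X : oriented_riemannian_manifold R d)
    (X_connected : connected [set: X]) (X_noncompact : ~ compact [set: X])
    (m : nonatomic_radon R X) :
  let lambda := lebesgue_poisson m in
  (forall (C1 C2 delta1 delta2 : R) (k1 k2 : borel (Gamma0 X) -> R),
    0 < C1 -> 0 < C2 -> 0 <= delta1 -> 0 <= delta2 ->
    K_space lambda C1 delta1 k1 -> K_space lambda C2 delta2 k2 ->
    let delta := Num.max delta1 delta2 in
    (K_space lambda (C1 + C2) delta (star_convolution k1 k2) /\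
     (K_norm lambda (C1 + C2) delta (star_convolution k1 k2) <=
        K_norm lambda C1 delta1 k1 * K_norm lambda C2 delta2 k2)%E) /\
    (1 <= delta -> C1 != C2 ->
     let Cbar := Num.max C1 C2 in
     K_space lambda Cbar delta (star_convolution k1 k2) /\
     (K_norm lambda Cbar delta (star_convolution k1 k2) <=
        (Cbar / `|C1 - C2|)%:E *
        (K_norm lambda C1 delta1 k1 * K_norm lambda C2 delta2 k2))%E) /\
    (1 <= delta -> C1 = C2 -> forall C' : R, C1 < C' ->
     K_space lambda C' delta (star_convolution k1 k2) /\
     (K_norm lambda C' delta (star_convolution k1 k2) <=
        (C' / (expR 1 * C1 * ln (C' / C1)))%:E *
        (K_norm lambda C1 delta1 k1 * K_norm lambda C2 delta2 k2))%E)) /\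
  (forall (C1 delta1 : R) (k1 k2 : borel (Gamma0 X) -> R),
    1 < C1 -> 1 <= delta1 ->
    K_space lambda C1 delta1 k1 -> k2 \in Lfun lambda +oo%E ->
    K_space lambda C1 delta1 (star_convolution k1 k2) /\
    (K_norm lambda C1 delta1 (star_convolution k1 k2) <=
       (C1 / (C1 - 1))%:E *
       (K_norm lambda C1 delta1 k1 * 'N[lambda]_+oo[EFin \o k2]))%E) /\
  (forall k1 k2 : borel (Gamma0 X) -> R,
    k1 \in Lfun lambda +oo%E -> k2 \in Lfun lambda +oo%E ->
    (forall C : R, 2 <= C ->
       K_space lambda C 0 (star_convolution k1 k2) /\
       (K_norm lambda C 0 (star_convolution k1 k2) <=
          'N[lambda]_+oo[EFin \o k1] * 'N[lambda]_+oo[EFin \o k2])%E) /\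
    (forall C delta : R, 0 < C -> 0 < delta ->
       K_space lambda C delta (star_convolution k1 k2))).
Proof.
move=> lambda.
have part2 (C1 C2 delta1 delta2 : R) (k1 k2 : borel (Gamma0 X) -> R) :
    0 < C1 -> 0 < C2 -> 0 <= delta1 -> 0 <= delta2 ->
    K_space lambda C1 delta1 k1 -> K_space lambda C2 delta2 k2 ->
    let delta := Num.max delta1 delta2 in 1 <= delta -> C1 != C2 ->
    let Cbar := Num.max C1 C2 in
    K_space lambda Cbar delta (star_convolution k1 k2) /\
    (K_norm lambda Cbar delta (star_convolution k1 k2) <=
      (Cbar / `|C1 - C2|)%:E *
      (K_norm lambda C1 delta1 k1 * K_norm lambda C2 delta2 k2))%E.
  move=> C10 C20 d1 d2 k1K k2K delta delta1_ge1 C12 Cbar.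
  apply: star_bound => //; first by rewrite lt_max C10.
  move=> eta; apply: le_trans
    (star_K_weight_le_sum eta (ltW C10) (ltW C20) d1 d2 delta1_ge1) _.
  rewrite /K_weight mulrA ler_wpM2r ?powR_ge0//.
  by apply: sum_expr_le => //; exact: ltW.
split; last split.
- move=> C1 C2 delta1 delta2 k1 k2 C10 C20 d1 d2 k1K k2K delta.
  split; [|split => [|delta_ge1 C12 C' CC']].
  + rewrite -[leRHS]mul1e; apply: star_bound => //; first exact: addr_gt0.
    by move=> eta; rewrite mul1r star_K_weight_le// ltW.
  + exact: part2.
  + subst C2; apply: star_bound => //; first exact: lt_trans CC'.
    move=> eta; apply: le_trans
      (star_K_weight_le_sum eta (ltW C10) (ltW C10) d1 d2 delta_ge1) _.
    rewrite /K_weight mulrA ler_wpM2r ?powR_ge0//.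
    under eq_bigr => j _ do rewrite -exprD subnKC ?leq_ord//.
    by rewrite sumr_const card_ord -[leLHS]mulr_natl succ_expr_le.
- move=> C1 delta1 k1 k2 C11 d1 k1K k2L; rewrite -K_norm10.
  have C10 : 0 < C1 by exact: lt_trans C11.
  have := @part2 C1 1 delta1 0 k1 k2 C10 ltr01 (le_trans ler01 d1) (lexx _)
    k1K (Lfun_K_space k2L).
  rewrite (max_idPl (le_trans ler01 d1)) (max_idPl (ltW C11)).
  rewrite gtr0_norm ?subr_gt0//.
  by apply => //; rewrite gt_eqF.
- move=> k1 k2 k1L k2L; rewrite -!K_norm10.
  have star10 (eta : Gamma0 X) : star_convolution (K_weight (1 : R) 0)
      (K_weight 1 0) eta <= 2 ^+ #|` eta|.
    have := @star_K_weight_le R X 1 0 1 0 eta ler01 ler01 (lexx _) (lexx _).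
    by rewrite /K_weight maxxx powRr0 mulr1.
  split=> [C C2|C delta C0 d0].
    have C0 : 0 < C by exact: lt_le_trans C2.
    rewrite -[leRHS]mul1e; apply: star_bound => //; try exact: Lfun_K_space.
    move=> eta; apply: le_trans (star10 eta) _.
    by rewrite mul1r /K_weight powRr0 mulr1 lerXn2r// nnegrE ltW.
  (* the constant c such that (2 / C) ^ n <= c * (n!) ^ delta for all n *)
  have [] // := @star_bound R d X m 1 0 1 0 C delta
    (expR ((2 / C) `^ delta^-1) `^ delta) k1 k2 ltr01 ltr01 C0 _
    (Lfun_K_space k1L) (Lfun_K_space k2L).
  move=> eta; apply: le_trans (star10 eta) _; rewrite /K_weight mulrCA.
  have := expr_le_fact_powR #|` eta| (divr_gt0 (ltr0Sn R 1) C0) d0.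
  by rewrite expr_div_n ler_pdivrMr ?exprn_gt0// mulrC.
Qed.
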